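(* Let $\mu_{m,n}$ be as in the context. Then: (1) for every $m\geq 0$, $\mu_{m,1}=\pi_m$; (2) for every $\beta>0$, as $m\to\infty$ with $n=\beta m$, the dilated measures $D_{1/m}(\mu_{m,\beta m})$ converge to the semicircle law $SC(1,\beta)$ with density $f(x)=\frac{\sqrt{4\beta-(1-x)^2}}{2\beta\pi}$ on $[1-2\sqrt\beta,1+2\sqrt\beta]$; (3) for every $t>0$, as $n\to\infty$ with $m=t/n$, $\mu_{t/n,n}$ converges to the law of $a-b$ where $a,b$ are free and both distributed according to $\pi_{t/2}$ (the modified free Bessel law $\tilde\pi_{2,t}$).
   Context: For real $m\geq0$, $n\geq1$, $\mu_{m,n}$ is the law of $a-b$, where $a,b$ are free self-adjoint random variables with $a\sim\pi_{m(n+1)/2}$ and $b\sim\pi_{m(n-1)/2}$; $\pi_t$ ($t\ge0$) is the free Poisson law $\pi_t=\max(1-t,0)\delta_0+\frac{\sqrt{4t-(x-1-t)^2}}{2\pi x}1_{[(\sqrt t-1)^2,(\sqrt t+1)^2]}(x)\,dx$. For $q\in\mathbb R$ and a probability measure $\mu$ (the law of $a$), $D_q(\mu)$ denotes the law of $qa$. Convergence is in the sense of moments (equivalently weak convergence, all measures being compactly supported with uniformly bounded supports). *)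

(* Defs.v *)
From Stdlib Require Import Reals Lra List ClassicalEpsilon.
Open Scope R_scope.

Record ncps := {
  car : Type;
  zero : car; one : car;
  add : car -> car -> car; mul : car -> car -> car;
  scal : R -> car -> car;
  phi : car -> R;
  add_assoc : forall x y z, add x (add y z) = add (add x y) z;
  add_comm : forall x y, add x y = add y x;
  add_zero : forall x, add x zero = x;
  scal_one : forall x, scal 1 x = x;
  scal_addl : forall r s x, scal (r + s) x = add (scal r x) (scal s x);
  scal_addr : forall r x y, scal r (add x y) = add (scal r x) (scal r y);
  scal_scal : forall r s x, scal r (scal s x) = scal (r * s) x;
  mul_assoc : forall x y z, mul x (mul y z) = mul (mul x y) z;
  mul_onel : forall x, mul one x = x;
  mul_oner : forall x, mul x one = x;
  mul_addl : forall x y z, mul (add x y) z = add (mul x z) (mul y z);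
  mul_addr : forall x y z, mul x (add y z) = add (mul x y) (mul x z);
  mul_scall : forall r x y, mul (scal r x) y = scal r (mul x y);
  mul_scalr : forall r x y, mul x (scal r y) = scal r (mul x y);
  phi_add : forall x y, phi (add x y) = phi x + phi y;
  phi_scal : forall r x, phi (scal r x) = r * phi x;
  phi_one : phi one = 1
}.

Arguments zero {_}. Arguments one {_}. Arguments add {_}. Arguments mul {_}.
Arguments scal {_}. Arguments phi {_}.

Definition sub {A : ncps} (x y : car A) : car A := add x (scal (-1) y).

Fixpoint npow {A : ncps} (x : car A) (k : nat) : car A :=
  match k with O => one | S k' => mul x (npow x k') end.

Fixpoint peval {A : ncps} (p : list R) (x : car A) : car A :=
  match p with nil => zero | c :: p' => add (scal c one) (mul x (peval p' x)) end.

(** Words: each letter is (true, p) meaning p(a), or (false, p) meaning p(b). *)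
Fixpoint alternating (l : list (bool * list R)) : Prop :=
  match l with
  | (i, _) :: (((j, _) :: _) as l') => i <> j /\ alternating l'
  | _ => True
  end.

Definition letter {A : ncps} (a b : car A) (e : bool * list R) : car A :=
  peval (snd e) (if fst e then a else b).

Definition word {A : ncps} (a b : car A) (l : list (bool * list R)) : car A :=
  fold_right (fun e acc => mul (letter a b e) acc) one l.

Definition free {A : ncps} (a b : car A) : Prop :=
  forall l : list (bool * list R), l <> nil -> alternating l ->
    Forall (fun e => phi (letter a b e) = 0) l -> phi (word a b l) = 0.

(** Riemann integral as a total function (junk value if not integrable). *)
Definition RInt (f : R -> R) (lo hi : R) : R :=
  epsilon (inhabits 0) (fun l => exists pr : Riemann_integrable f lo hi, RiemannInt pr = l).

(** k-th moment of the free Poisson law pi_t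
    = max(1-t,0) delta_0 + sqrt(4t-(x-1-t)^2)/(2 pi x) dx on [(sqrt t-1)^2,(sqrt t+1)^2].
    For k >= 1 the factor x^k / x is written as x^(k-1); moment 0 is the total mass 1. *)
Definition mom_pi (t : R) (k : nat) : R :=
  match k with
  | O => 1
  | S j => Rmax (1 - t) 0 * 0 ^ (S j)
           + RInt (fun x => x ^ j * sqrt (4 * t - (x - 1 - t) ^ 2) / (2 * PI))
                  ((sqrt t - 1) ^ 2) ((sqrt t + 1) ^ 2)
  end.

Definition has_law_pi {A : ncps} (x : car A) (t : R) : Prop :=
  forall k, phi (npow x k) = mom_pi t k.

(** (A,a,b) realizes mu_{m,n}: a,b free, a ~ pi_{m(n+1)/2}, b ~ pi_{m(n-1)/2};
    mu_{m,n} is then the law of a - b. *)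
Definition realizes_mu (m n : R) (A : ncps) (a b : car A) : Prop :=
  free a b /\ has_law_pi a (m * (n + 1) / 2) /\ has_law_pi b (m * (n - 1) / 2).

Definition mom_SC (beta : R) (k : nat) : R :=
  RInt (fun x => x ^ k * (sqrt (4 * beta - (1 - x) ^ 2) / (2 * beta * PI)))
       (1 - 2 * sqrt beta) (1 + 2 * sqrt beta).

Definition lim_pinf (g : R -> R) (l : R) : Prop :=
  forall eps, eps > 0 -> exists M, forall x, x >= M -> Rabs (g x - l) < eps.

(* Main.v *)
(* Joint moments of a free pair are polynomials in the marginal moments, so limits
   of the marginals pass to the law of a - b. Centred free Poisson laws and
   semicircle laws both have tridiagonal (Jacobi) moment recursions: the centred
   law of rate t has off-diagonal entries sqrt t and diagonal 0, 1, 1, ..., which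
   after dilation by 1/m with t ~ beta m^2 / 2 tend to those of the semicircle law
   of variance beta / 2. Two free copies of the latter are realized by creation and
   annihilation operators on the full Fock space over a plane, and their difference
   is semicircular of variance beta by rotation. In the other regime the rates tend
   to t / 2, and for n = 1 the second variable has the moments of 0. *)
From Coquelicot Require Import Coquelicot.
Require Import Defs.
From Stdlib Require Import Reals List.
From Stdlib Require Import Lra Lia Morphisms FunctionalExtensionality ProofIrrelevance.
Open Scope R_scope.

(** * Elements of a probability space up to indistinguishability *)

Section Indistinguishable.

Context {A : ncps}.
Implicit Types x y u v : car A.

(** Expanding [add one zero], which equals [one], between [u] and [v] shows by additivity of [phi]
    that the extra term has value 0. *)
Lemma phi_zero_mid u v : phi (mul (mul u zero) v) = 0.
Proof.
  assert (H : phi (mul (mul u (add one zero)) v) = phi (mul (mul u one) v))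
    by now rewrite add_zero.
  rewrite mul_addr, mul_addl, phi_add in H. lra.
Qed.

(* The axioms of [ncps] do not give [scal 0 x = zero], so identities between
   elements are only used up to this congruence, which [phi] respects. *)
Record indist x y : Prop := Indist {
  indist_phi : forall u v, phi (mul (mul u x) v) = phi (mul (mul u y) v)
}.

#[global] Instance indist_equiv : Equivalence indist.
Proof.
  split.
  - intros x. split. reflexivity.
  - intros x y [H]. split. intros u v. now rewrite H.
  - intros x y z [H] [H']. split. intros u v. now rewrite H.
Qed.

#[global] Instance add_indist : Proper (indist ==> indist ==> indist) add.
Proof.
  intros x x' [Hx] y y' [Hy]. split. intros u v.
  now rewrite !mul_addr, !mul_addl, !phi_add, Hx, Hy.
Qed.

#[global] Instance scal_indist : Proper (eq ==> indist ==> indist) scal.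
Proof.
  intros r ? <- x x' [Hx]. split. intros u v.
  now rewrite !mul_scalr, !mul_scall, !phi_scal, Hx.
Qed.

#[global] Instance mul_indist : Proper (indist ==> indist ==> indist) mul.
Proof.
  intros x x' [Hx] y y' [Hy]. split. intros u v.
  rewrite (mul_assoc A u x y), (mul_assoc A u x' y'), Hy.
  rewrite <- (mul_assoc A (mul u x)), <- (mul_assoc A (mul u x')). apply Hx.
Qed.

#[global] Instance phi_indist : Proper (indist ==> eq) phi.
Proof.
  intros x y [H]. generalize (H one one). now rewrite !mul_oner, !mul_onel.
Qed.

#[global] Instance npow_indist : Proper (indist ==> eq ==> indist) npow.
Proof.
  intros x y H k ? <-. induction k; simpl; [reflexivity | now apply mul_indist].
Qed.

#[global] Instance peval_indist : Proper (eq ==> indist ==> indist) peval.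
Proof.
  intros p ? <- x y H. induction p; simpl; [reflexivity|].
  now apply add_indist, mul_indist.
Qed.

Lemma zero_indist : indist zero (scal 0 one).
Proof.
  split. intros u v. rewrite phi_zero_mid, mul_scalr, mul_scall, phi_scal. ring.
Qed.

End Indistinguishable.

Infix "==" := indist (at level 70).

(** Expands both sides inside an arbitrary context [phi (mul (mul u _) v)] into linear combinations
    of moments of words, which leaves an identity in R for [ring]. *)
Ltac indist_solve :=
  rewrite ?zero_indist; let u := fresh in let v := fresh in split; intros u v; unfold sub;
  repeat (rewrite mul_addl || rewrite mul_addr || rewrite mul_scall || rewrite mul_scalr
          || rewrite phi_add || rewrite phi_scal || rewrite mul_assoc
          || rewrite mul_onel || rewrite mul_oner);
  try ring.

(** * Polynomials in one element *)

Section Polynomials.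

Context {A : ncps}.
Implicit Types (x : car A) (p q : list R).

Fixpoint padd p q :=
  match p, q with
  | nil, _ => q
  | _, nil => p
  | c :: p', d :: q' => c + d :: padd p' q'
  end.

Fixpoint pmul p q :=
  match p with
  | nil => nil
  | c :: p' => padd (map (Rmult c) q) (0 :: pmul p' q)
  end.

Lemma peval_padd p q x : peval (padd p q) x == add (peval p x) (peval q x).
Proof.
  revert q. induction p as [|c p IH]; intros [|d q]; simpl.
  1-3: indist_solve.
  rewrite IH. indist_solve.
Qed.

Lemma peval_pscal r p x : peval (map (Rmult r) p) x == scal r (peval p x).
Proof.
  induction p as [|c p IH]; simpl; [|rewrite IH]; indist_solve.
Qed.

Lemma peval_pmul p q x : peval (pmul p q) x == mul (peval p x) (peval q x).
Proof.
  induction p as [|c p IH]; cbn [pmul peval]; [indist_solve|].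
  rewrite peval_padd, peval_pscal. cbn [peval]. rewrite IH. indist_solve.
Qed.

Definition in_alg x y := exists p, y == peval p x.

Lemma in_alg_peval x y p : in_alg x y -> in_alg x (peval p y).
Proof.
  intros [q Hq]. induction p as [|c p [r Hr]]; simpl.
  - exists nil. reflexivity.
  - exists (padd (c :: nil) (pmul q r)).
    rewrite peval_padd, peval_pmul, <- Hq, <- Hr. cbn [peval]. indist_solve.
Qed.

Lemma npow_indist_scal r x k : npow (scal r x) k == scal (r ^ k) (npow x k).
Proof.
  induction k; simpl; [|rewrite IHk]; indist_solve.
Qed.

Lemma npow_succ_r x k : npow x (S k) = mul (npow x k) x.
Proof.
  induction k; simpl.
  - now rewrite mul_onel, mul_oner.
  - simpl in IHk. now rewrite IHk at 1; rewrite mul_assoc.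
Qed.

End Polynomials.

(** * Alternating words and freeness of subalgebras *)

Fixpoint alt (l : list bool) : Prop :=
  match l with
  | i :: ((j :: _) as l') => i <> j /\ alt l'
  | _ => True
  end.

Lemma alternating_fst (l : list (bool * list R)) : alt (map fst l) -> alternating l.
Proof.
  induction l as [|[i p] [|[j q] l] IH]; auto.
  intros [H1 H2]. split; auto.
Qed.

(** Serves induction on the length of a word: when freeness does not apply directly, two neighbours
    from the same subalgebra can be merged. *)
Lemma alt_or_repeat {T} (l : list (bool * T)) :
  alt (map fst l) \/ exists l1 t x y l2, l = l1 ++ (t, x) :: (t, y) :: l2.
Proof.
  induction l as [|[i x] [|[j y] l] IH].
  - now left.
  - now left.
  - destruct (Bool.bool_dec i j) as [<-|Hij].
    { right. now exists nil, i, x, y, l. }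
    destruct IH as [IH|(l1 & t & x' & y' & l2 & E)].
    + left. now split.
    + right. exists ((i, x) :: l1), t, x', y', l2. now rewrite E.
Qed.

Definition product {A : ncps} (l : list (car A)) : car A := fold_right mul one l.

Lemma prod_app {A : ncps} (l1 l2 : list (car A)) :
  product (l1 ++ l2) = mul (product l1) (product l2).
Proof.
  induction l1; simpl; [now rewrite mul_onel | now rewrite IHl1, mul_assoc].
Qed.

(** Freeness is stated for polynomials; since [phi] respects [==], it carries over to elements of
    the two subalgebras that are given only up to [==]. *)
Lemma free_prod {A : ncps} (a b : car A) (l : list (bool * car A)) :
  free a b -> l <> nil -> alt (map fst l) ->
  Forall (fun e : bool * car A => in_alg (if fst e then a else b) (snd e) /\ phi (snd e) = 0) l ->
  phi (product (map snd l)) = 0.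
Proof.
  intros Hfree Hnil Halt Hl.
  assert (H : exists l', map fst l' = map fst l /\ word a b l' == product (map snd l)
                /\ Forall (fun e => phi (letter a b e) = 0) l').
  { clear Hnil Halt. induction Hl as [|[t x] l [[p Hp] Hx] _ (l' & E1 & E2 & E3)].
    - exists nil. simpl. repeat split; auto; reflexivity.
    - simpl in Hp, Hx. exists ((t, p) :: l'). simpl. repeat split.
      + now rewrite E1.
      + apply mul_indist; [now symmetry | exact E2].
      + constructor; auto. unfold letter; simpl. now rewrite <- Hp. }
  destruct H as (l' & E1 & E2 & E3).
  rewrite <- E2. apply Hfree; auto.
  - intros ->. destruct l; [auto | discriminate].
  - apply alternating_fst. now rewrite E1.
Qed.

Lemma free_in_alg {A : ncps} (a b a' b' : car A) :
  free a b -> in_alg a a' -> in_alg b b' -> free a' b'.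
Proof.
  intros Hfree Ha Hb l Hnil Halt Hl.
  set (l' := map (fun e => (fst e, letter a' b' e)) l).
  replace (word a' b' l) with (product (map snd l')).
  - apply (free_prod a b); auto; unfold l'.
    + destruct l; [auto | discriminate].
    + rewrite map_map; simpl. clear - Halt.
      induction l as [|[i p] [|[j q] l] IH]; simpl; auto.
      destruct Halt as [H1 H2]. split; [auto | exact (IH H2)].
    + apply Forall_map. eapply Forall_impl; [|exact Hl].
      intros [t p] H. split; [|exact H]. unfold letter; simpl.
      destruct t; now apply in_alg_peval.
  - unfold l'. clear. induction l; simpl; [reflexivity | now rewrite <- IHl].
Qed.

(** * Universality of joint moments *)

(* Joint moments of a free pair are universal polynomials in the marginal
   moments; this is expressed by saying that they lie in every algebra [C] of
   functions of the parameter [i] which contains the marginal moments. *)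
Section Universality.

Variables (I : Type) (C : (I -> R) -> Prop).
Hypothesis C_const : forall r, C (fun _ => r).
Hypothesis C_add : forall f g, C f -> C g -> C (fun i => f i + g i).
Hypothesis C_mul : forall f g, C f -> C g -> C (fun i => f i * g i).

Lemma C_ext f g : C f -> (forall i, f i = g i) -> C g.
Proof.
  intros Hf H. now replace g with f by now apply functional_extensionality.
Qed.

(** All lists of a family have the same length, so one induction on the coefficients serves every
    parameter at once. *)
Inductive poly_family : (I -> list R) -> Prop :=
| poly_family_nil : poly_family (fun _ => nil)
| poly_family_cons c p : C c -> poly_family p -> poly_family (fun i => c i :: p i).

Lemma poly_family_padd p q :
  poly_family p -> poly_family q -> poly_family (fun i => padd (p i) (q i)).
Proof.
  intros Hp. revert q. induction Hp as [|c p Hc Hp IH]; intros q Hq; [exact Hq|].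
  destruct Hq as [|d q Hd Hq]; simpl; constructor; auto.
Qed.

Lemma poly_family_pscal c p :
  C c -> poly_family p -> poly_family (fun i => map (Rmult (c i)) (p i)).
Proof.
  intros Hc Hp. induction Hp; simpl; constructor; auto.
Qed.

Lemma poly_family_pmul p q :
  poly_family p -> poly_family q -> poly_family (fun i => pmul (p i) (q i)).
Proof.
  intros Hp Hq. induction Hp as [|c p Hc Hp IH]; cbn [pmul]; [constructor|].
  apply poly_family_padd; [now apply poly_family_pscal|].
  now apply (poly_family_cons (fun _ => 0)).
Qed.

Variables (F : I -> ncps) (a b : forall i, car (F i)).
Hypothesis Hfree : forall i, free (a i) (b i).
Hypothesis Ha : forall k, C (fun i => phi (npow (a i) k)).
Hypothesis Hb : forall k, C (fun i => phi (npow (b i) k)).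

Definition gen (t : bool) i : car (F i) := if t then a i else b i.

Definition alg_family t (x : forall i, car (F i)) :=
  exists p, poly_family p /\ forall i, x i == peval (p i) (gen t i).

Lemma alg_family_gen t : alg_family t (gen t).
Proof.
  exists (fun _ => 0 :: 1 :: nil). split.
  - repeat apply (poly_family_cons (fun _ => _)); auto. constructor.
  - intros i. simpl. indist_solve.
Qed.

Lemma alg_family_mul t x y :
  alg_family t x -> alg_family t y -> alg_family t (fun i => mul (x i) (y i)).
Proof.
  intros (p & Hp & Ep) (q & Hq & Eq). exists (fun i => pmul (p i) (q i)). split.
  - now apply poly_family_pmul.
  - intros i. now rewrite peval_pmul, <- Ep, <- Eq.
Qed.

Lemma alg_family_shift t x c :
  C c -> alg_family t x -> alg_family t (fun i => add (x i) (scal (c i) one)).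
Proof.
  intros Hc (p & Hp & Ep). exists (fun i => padd (p i) (c i :: nil)). split.
  - apply poly_family_padd; auto. apply poly_family_cons; auto. constructor.
  - intros i. rewrite peval_padd, <- Ep. cbn [peval]. indist_solve.
Qed.

Lemma alg_family_phi t x : alg_family t x -> C (fun i => phi (x i)).
Proof.
  intros (p & Hp & Ep).
  (* The exponent 0 is generalised next: in the induction, splitting off a coefficient of [p] raises
     the exponent by one. *)
  apply (C_ext (fun i => phi (mul (npow (gen t i) 0) (peval (p i) (gen t i))))).
  2:{ intros i. simpl. now rewrite mul_onel, Ep. }
  generalize O. clear x Ep. induction Hp as [|c p Hc Hp IH]; intros k.
  - apply (C_ext _ _ (C_const 0)). intros i. simpl.
    generalize (phi_zero_mid (npow (gen t i) k) one). now rewrite mul_oner.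
  - eapply C_ext.
    + refine (C_add _ _ (C_mul c (fun i => phi (npow (gen t i) k)) Hc _) (IH (S k))).
      destruct t; [apply Ha | apply Hb].
    + intros i. cbv beta. rewrite npow_succ_r. cbn [peval].
      now rewrite mul_addr, mul_scalr, mul_oner, phi_add, phi_scal, mul_assoc.
Qed.

Definition word_at (l : list (bool * forall i, car (F i))) i : car (F i) :=
  product (map (fun e => snd e i) l).

Definition alg_word (l : list (bool * forall i, car (F i))) :=
  Forall (fun e : bool * _ => alg_family (fst e) (snd e)) l.

Lemma word_at_app l1 l2 i : word_at (l1 ++ l2) i = mul (word_at l1 i) (word_at l2 i).
Proof.
  unfold word_at. now rewrite map_app, prod_app.
Qed.

Lemma word_at_cons t x l i : word_at ((t, x) :: l) i = mul (x i) (word_at l i).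
Proof.
  reflexivity.
Qed.

(** The letters are centred from left to right, [l1] being the part already centred. Writing the
    next letter as its centred version plus a scalar gives a word with one more centred letter and a
    strictly shorter word, covered by the induction hypothesis. Once every letter is centred,
    freeness gives 0. *)
Lemma word_moment_alt (N : nat) :
  (forall l, (length l <= N)%nat -> alg_word l -> C (fun i => phi (word_at l i))) ->
  forall l2 l1, (length (l1 ++ l2) <= S N)%nat -> alg_word (l1 ++ l2) ->
  alt (map fst (l1 ++ l2)) ->
  Forall (fun e => forall i, phi (snd e i) = 0) l1 ->
  C (fun i => phi (word_at (l1 ++ l2) i)).
Proof.
  intros IHN. induction l2 as [|[t x] l2 IH]; intros l1 Hlen Halg_word Halt H0.
  - rewrite app_nil_r in *.
    assert (E : l1 = nil \/ l1 <> nil) by (destruct l1; [now left | now right]).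
    destruct E as [->|Hnil].
    (* [free] speaks of nonempty words only; the empty word has value 1. *)
    + apply (C_ext _ _ (C_const 1)). intros i. symmetry. apply phi_one.
    + apply (C_ext _ _ (C_const 0)). intros i. symmetry.
      unfold word_at.
      replace (map (fun e => snd e i) l1)
        with (map snd (map (fun e => (fst e, snd e i)) l1)) by now rewrite map_map.
      apply (free_prod (a i) (b i)).
      * auto.
      * now destruct l1.
      * now rewrite map_map.
      * apply Forall_map. apply Forall_forall. intros [t x] He. simpl.
        unfold alg_word in Halg_word. rewrite Forall_forall in Halg_word, H0. split.
        -- destruct (Halg_word _ He) as (p & _ & Hp). exists (p i). apply Hp.
        -- exact (H0 _ He i).
  - assert (Hx : alg_family t x) by (apply Forall_elt in Halg_word; exact Halg_word).
    assert (Hc : C (fun i => phi (x i))) by now apply (alg_family_phi t).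
    assert (Hc' : C (fun i => - phi (x i))).
    { apply (C_ext _ _ (C_mul _ _ (C_const (-1)) Hc)). intros i. simpl. ring. }
    set (x0 := fun i => add (x i) (scal (- phi (x i)) one)).
    assert (H1 : C (fun i => phi (word_at (l1 ++ l2) i))).
    { apply IHN.
      - rewrite length_app in *. simpl in Hlen. lia.
      - apply Forall_app in Halg_word. destruct Halg_word as [G1 G2]. inversion G2.
        now apply Forall_app. }
    assert (H2 : C (fun i => phi (word_at ((l1 ++ (t, x0) :: nil) ++ l2) i))).
    { apply IH; rewrite <- ?app_assoc; simpl.
      - rewrite length_app in *. simpl in *. lia.
      - apply Forall_app in Halg_word. destruct Halg_word as [G1 G2]. inversion G2.
        apply Forall_app. split; auto. constructor; auto.
        now apply alg_family_shift.
      - now rewrite map_app in *.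
      - apply Forall_app. split; auto. constructor; auto. intros i. simpl. unfold x0.
        rewrite phi_add, phi_scal, phi_one. ring. }
    apply (C_ext _ _ (C_add _ _ H2 (C_mul _ _ Hc H1))). intros i. cbv beta.
    rewrite <- app_assoc. simpl.
    rewrite !word_at_app, !word_at_cons. unfold x0.
    rewrite mul_addl, !mul_addr, !phi_add, mul_scall, mul_scalr, phi_scal, mul_onel. ring.
Qed.

(** Induction on a bound for the length: an alternating word is handled by centring, any other one
    becomes shorter by multiplying two neighbours. *)
Lemma word_moment l : alg_word l -> C (fun i => phi (word_at l i)).
Proof.
  remember (length l) as N eqn:E. assert (HN : (length l <= N)%nat) by lia. clear E.
  revert l HN. induction N as [|N IH]; intros l HN Hl.
  - destruct l; [|simpl in HN; lia].
    apply (C_ext _ _ (C_const 1)). intros i. symmetry. apply phi_one.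
  - destruct (alt_or_repeat l) as [Halt|(l1 & t & x & y & l2 & ->)].
    + now apply (word_moment_alt N IH l nil).
    + eapply C_ext.
      * apply (IH (l1 ++ (t, fun i => mul (x i) (y i)) :: l2)).
        -- rewrite length_app in *. simpl in *. lia.
        -- apply Forall_app in Hl. destruct Hl as [G1 G2]. inversion_clear G2.
           inversion_clear H0. apply Forall_app. split; auto. constructor; auto.
           now apply alg_family_mul.
      * intros i. now rewrite !word_at_app, !word_at_cons, !mul_assoc.
Qed.

(** The shift [z] will restore the difference of the means after [a] and [b] have been replaced by
    centred variables. *)
Theorem free_sub_moments (z : I -> R) k :
  C z -> C (fun i => phi (npow (add (scal (z i) one) (sub (a i) (b i))) k)).
Proof.
  intros Hz.
  (* A word is allowed in front of the power, so that each factor expanded from the power can be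
     appended to it. *)
  enough (H : forall l, alg_word l ->
    C (fun i => phi (mul (word_at l i) (npow (add (scal (z i) one) (sub (a i) (b i))) k)))).
  { apply (C_ext _ _ (H nil (Forall_nil _))). intros i. cbn. now rewrite mul_onel. }
  induction k as [|k IH]; intros l Hl.
  - apply (C_ext _ _ (word_moment l Hl)). intros i. simpl. now rewrite mul_oner.
  - assert (G : forall t, alg_word (l ++ (t, gen t) :: nil)).
    { intros t. apply Forall_app. split; auto. constructor; auto. apply alg_family_gen. }
    eapply C_ext.
    + refine (C_add _ _ (C_mul _ _ Hz (IH l Hl)) (C_add _ _ (IH _ (G true))
                (C_mul _ _ (C_const (-1)) (IH _ (G false))))).
    + intros i. cbv beta. rewrite !word_at_app, !word_at_cons. cbn [npow].
      change (word_at nil i) with (@one (F i)). rewrite !mul_oner. cbn [gen]. unfold sub.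
      rewrite !mul_addl, !mul_addr, !mul_scall, !mul_scalr, !phi_add, !phi_scal, !mul_onel, !mul_assoc.
      reflexivity.
Qed.

End Universality.

(** * Moments of free Poisson and semicircle laws *)

(* [jac p a0 al k j] is the entry (0, j) of the k-th power of the tridiagonal
   matrix with off-diagonal entries p and diagonal a0, al, al, ... *)
Fixpoint jac (p a0 al : R) (k j : nat) : R :=
  match k, j with
  | O, O => 1
  | O, S _ => 0
  | S k, O => a0 * jac p a0 al k 0 + p * jac p a0 al k 1
  | S k, S j => p * jac p a0 al k j + al * jac p a0 al k (S j) + p * jac p a0 al k (S (S j))
  end.

Lemma jac_scal r p a0 al k j :
  jac (r * p) (r * a0) (r * al) k j = r ^ k * jac p a0 al k j.
Proof.
  revert j. induction k as [|k IH]; intros [|j]; simpl; rewrite ?IH; ring.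
Qed.

(* Multiplying the centred free Poisson law by its variable gives a shifted
   semicircle law; on Jacobi coefficients this is the following identity. *)
Lemma jac_poisson_semicircle p k j :
  p * jac p 1 1 k j = jac p 0 1 k (S j) + p * jac p 0 1 k j.
Proof.
  revert j. induction k as [|k IH]; intros j.
  - destruct j; simpl; ring.
  - assert (E : forall i, jac p 0 1 k (S i) = p * jac p 1 1 k i - p * jac p 0 1 k i)
      by (intros i; rewrite IH; ring).
    destruct j as [|j]; simpl; rewrite !E; ring.
Qed.

Lemma ex_RInt_cont (f : R -> R) lo hi : (forall x, continuous f x) -> ex_RInt f lo hi.
Proof.
  intros Hf. apply (ex_RInt_continuous (V := R_CompleteNormedModule)). auto.
Qed.

Lemma RInt_Defs (f : R -> R) (lo hi : R) :
  (forall x, continuous f x) -> Defs.RInt f lo hi = RInt.RInt f lo hi.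
Proof.
  intros Hf. unfold Defs.RInt.
  destruct (ClassicalEpsilon.epsilon_spec (inhabits 0)
    (fun l => exists pr : Riemann_integrable f lo hi, RiemannInt pr = l)) as [pr <-].
  - exists (RiemannInt (ex_RInt_Reals_0 f lo hi (ex_RInt_cont f lo hi Hf))). eauto.
  - symmetry. apply RInt_Reals.
Qed.

Lemma continuous_derivable (f : R -> R) : (forall x, ex_derive f x) -> forall x, continuous f x.
Proof.
  intros Hf x. apply (ex_derive_continuous (V := R_NormedModule)). auto.
Qed.

Lemma RInt_linear (f g : R -> R) (r s lo hi : R) :
  (forall x, continuous f x) -> (forall x, continuous g x) ->
  RInt.RInt (fun x => r * f x + s * g x) lo hi
  = r * RInt.RInt f lo hi + s * RInt.RInt g lo hi.
Proof.
  intros Hf Hg.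
  apply is_RInt_unique.
  apply (is_RInt_plus (V := R_NormedModule)); apply (is_RInt_scal (V := R_NormedModule));
    apply (RInt_correct (V := R_CompleteNormedModule)); now apply ex_RInt_cont.
Qed.

(* [RInt_ext] at type [R], so that [ring] and [field] see the right equality. *)
Lemma RInt_ext_R (f g : R -> R) (lo hi : R) :
  (forall x : R, Rmin lo hi < x < Rmax lo hi -> f x = g x) ->
  RInt.RInt f lo hi = RInt.RInt g lo hi.
Proof.
  exact (RInt_ext f g lo hi).
Qed.

Lemma RInt_cos_mult n : RInt.RInt (fun x => cos (INR n * x)) 0 PI = if Nat.eqb n 0 then PI else 0.
Proof.
  destruct n as [|n]; simpl Nat.eqb; cbv iota.
  - rewrite (RInt_ext_R _ (fun _ => 1)).
    + rewrite RInt_const. unfold Hierarchy.scal; simpl. unfold mult; simpl. ring.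
    + intros x _. simpl. now rewrite Rmult_0_l, cos_0.
  - assert (Hn : INR (S n) <> 0) by now apply not_0_INR.
    assert (Hs : sin (INR (S n) * PI) = 0).
    { apply sin_eq_0_1. exists (Z.of_nat (S n)). now rewrite INR_IZR_INZ. }
    revert Hn Hs. generalize (INR (S n)). intros r Hr Hs.
    apply is_RInt_unique.
    replace 0 with (minus (sin (r * PI) / r) (sin (r * 0) / r)) at 2.
    + apply (is_RInt_derive (V := R_CompleteNormedModule) (fun x => sin (r * x) / r)).
      * intros x _. auto_derive; auto. field; auto.
      * intros x _. revert x. apply continuous_derivable. intros y. auto_derive. auto.
    + rewrite Rmult_0_r, sin_0, Hs. unfold minus, plus, opp; simpl. field; auto.
Qed.

(* The functions sin ((j+1) x) / sin x are the Chebyshev polynomials in 2 cos x,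
   orthonormal for the weight 2/PI sin^2 x. *)
Definition cheb (p : R) (k j : nat) (x : R) : R :=
  (1 + 2 * p * cos x) ^ k * (sin x * sin (INR (S j) * x)).

Lemma cheb_continuous p k j x : continuous (cheb p k j) x.
Proof.
  revert x. apply continuous_derivable. intros x. unfold cheb. auto_derive. auto.
Qed.

Lemma sin_step j x :
  2 * cos x * sin (INR (S j) * x) = sin (INR (S (S j)) * x) + sin (INR j * x).
Proof.
  replace (INR (S (S j)) * x) with (INR (S j) * x + x) by (rewrite (S_INR (S j)); ring).
  replace (INR j * x) with (INR (S j) * x - x) by (rewrite (S_INR j); ring).
  rewrite sin_plus, sin_minus. ring.
Qed.

(** By the three-term recurrence [sin_step], multiplication by 1 + 2p cos x acts on the index [j] as
    the tridiagonal matrix with diagonal 1; the case k = 0 is orthogonality of the Chebyshev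
    functions. *)
Lemma RInt_cheb p k j : RInt.RInt (cheb p k j) 0 PI = PI / 2 * jac p 1 1 k j.
Proof.
  revert j. induction k as [|k IH]; intros j.
  - rewrite (RInt_ext_R _ (fun x => (1/2) * cos (INR j * x) + (-1/2) * cos (INR (S (S j)) * x))).
    + rewrite RInt_linear, !RInt_cos_mult.
      * destruct j; simpl; field.
      * apply continuous_derivable. intros x. auto_derive. auto.
      * apply continuous_derivable. intros x. auto_derive. auto.
    + intros x _. unfold cheb. simpl pow.
      replace (INR j * x) with (INR (S j) * x - x) by (rewrite (S_INR j); ring).
      replace (INR (S (S j)) * x) with (INR (S j) * x + x) by (rewrite (S_INR (S j)); ring).
      rewrite cos_plus, cos_minus. field.
  - destruct j as [|j].
    + rewrite (RInt_ext_R _ (fun x => 1 * cheb p k 0 x + p * cheb p k 1 x)).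
      * rewrite RInt_linear, !IH by apply cheb_continuous. simpl. ring.
      * intros x _. unfold cheb. generalize (sin_step 0 x). simpl INR at 3.
        rewrite Rmult_0_l, sin_0. intros E. cbn [pow].
        transitivity ((1 + 2 * p * cos x) ^ k * sin x *
          (sin (INR 1 * x) + p * (2 * cos x * sin (INR 1 * x)))); [ring|rewrite E; ring].
    + rewrite (RInt_ext_R _ (fun x => 1 * (p * cheb p k j x + 1 * cheb p k (S j) x)
                                    + p * cheb p k (S (S j)) x)).
      * rewrite (RInt_linear (fun x => p * cheb p k j x + 1 * cheb p k (S j) x)), RInt_linear, !IH;
          try apply cheb_continuous; [simpl; ring|].
        apply continuous_derivable. intros x. unfold cheb. auto_derive. auto.
      * intros x _. unfold cheb. generalize (sin_step (S j) x). intros E. cbn [pow].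
        transitivity ((1 + 2 * p * cos x) ^ k * sin x *
          (sin (INR (S (S j)) * x) + p * (2 * cos x * sin (INR (S (S j)) * x))));
          [ring|rewrite E; ring].
Qed.

(** Up to constants, c = 1 gives the integrand of [mom_SC], and c = t + 1 that of x (x - t)^k
    against the free Poisson law. The power is shifted so that the integral does not depend on
    [c]. *)
Definition semicircle (p c : R) (k : nat) (x : R) : R :=
  (x - c + 1) ^ k * sqrt (4 * p ^ 2 - (x - c) ^ 2).

Lemma semicircle_continuous p c k x : continuous (semicircle p c k) x.
Proof.
  apply (continuous_mult (K := R_AbsRing)).
  - apply (continuous_derivable (fun x => (x - c + 1) ^ k)). intros y. auto_derive. auto.
  - apply continuous_sqrt_comp.
    apply (continuous_derivable (fun x => 4 * p ^ 2 - (x - c) ^ 2)).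
    intros y. auto_derive. auto.
Qed.

Lemma semicircle_integral p c k : 0 <= p ->
  RInt.RInt (semicircle p c k) (c - 2 * p) (c + 2 * p)
  = 2 * PI * p ^ 2 * jac p 1 1 k 0.
Proof.
  intros Hp.
  set (f := semicircle p c k).
  assert (Hf : forall x, continuous f x) by apply semicircle_continuous.
  (* The substitution x = c + 2p cos u on [0, PI] reverses orientation, so the bounds are swapped
     first. *)
  rewrite <- (opp_RInt_swap f) by now apply ex_RInt_cont.
  replace (c + 2 * p) with (c + 2 * p * cos 0) by (rewrite cos_0; ring).
  replace (c - 2 * p) with (c + 2 * p * cos PI) by (rewrite cos_PI; ring).
  rewrite <- (RInt_comp f (fun x => c + 2 * p * cos x) (fun x => - (2 * p * sin x))).
  (* The summand with coefficient 0 only gives the integrand the shape of [RInt_linear]. *)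
  - rewrite (RInt_ext_R _ (fun x => (- (4 * p ^ 2)) * cheb p k 0 x + 0 * cheb p k 0 x)).
    + rewrite RInt_linear, RInt_cheb by apply cheb_continuous.
      unfold opp; simpl. field.
    + rewrite Rmin_left, Rmax_right by (generalize PI_RGT_0; lra).
      intros x Hx. unfold f, semicircle, cheb, Hierarchy.scal; simpl. unfold mult; simpl.
      assert (Hs : 0 <= sin x) by (apply sin_ge_0; lra).
      replace (c + 2 * p * cos x - c) with (2 * p * cos x) by ring.
      generalize (sin2_cos2 x). unfold Rsqr. intros E.
      replace (4 * (p * (p * 1)) - 2 * p * cos x * (2 * p * cos x * 1))
        with ((2 * p * sin x) * (2 * p * sin x))
        by (transitivity (4 * (p * p) * (1 - cos x * cos x)); [rewrite <- E|]; ring).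
      rewrite sqrt_square by (apply Rmult_le_pos; lra).
      rewrite Rmult_1_l. replace (2 * p * cos x + 1) with (1 + 2 * p * cos x) by ring. ring.
  - auto.
  - intros x _. split.
    + auto_derive; auto. ring.
    + apply (continuous_derivable (fun x => - (2 * p * sin x))). intros y. auto_derive. auto.
Qed.

Lemma mom_SC_jac beta k : 0 < beta -> mom_SC beta k = jac (sqrt beta) 1 1 k 0.
Proof.
  intros Hb. assert (Hs : sqrt beta ^ 2 = beta) by (apply pow2_sqrt; lra).
  unfold mom_SC. set (p := sqrt beta) in *. rewrite <- Hs in *.
  generalize PI_RGT_0. intros Hpi.
  assert (Hp : 0 <= p) by apply sqrt_pos.
  set (g := semicircle p 1 k).
  assert (Hg : forall x, continuous g x) by apply semicircle_continuous.
  replace (fun x => x ^ k * (sqrt (4 * p ^ 2 - (1 - x) ^ 2) / (2 * p ^ 2 * PI)))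
    with (fun x => / (2 * p ^ 2 * PI) * g x + 0 * g x).
  - rewrite RInt_Defs.
    + rewrite RInt_linear by auto. unfold g. rewrite semicircle_integral by auto.
      field. split; [lra|]. intros E. rewrite E in Hb. lra.
    + intros x. apply (continuous_plus (V := R_NormedModule));
        apply (continuous_scal_r (V := R_NormedModule)); auto.
  - apply functional_extensionality. intros x. unfold g, semicircle.
    replace (x - 1 + 1) with x by ring. replace ((x - 1) ^ 2) with ((1 - x) ^ 2) by ring.
    unfold Rdiv. ring.
Qed.

(** The factor [x] kills the atom at 0 and cancels the 1/x of the density. What remains is a
    semicircle of radius 2 [sqrt t] centred at t + 1, and x - t is the deviation from that centre
    plus 1. *)
Lemma mom_pi_shift {A : ncps} (x : car A) t k : 0 <= t -> has_law_pi x t ->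
  phi (mul x (npow (add x (scal (- t) one)) k)) = t * jac (sqrt t) 1 1 k 0.
Proof.
  intros Ht Hx. assert (Hs : sqrt t ^ 2 = t) by (apply pow2_sqrt; lra).
  set (w := fun j k y => y ^ j * (y - t) ^ k * (sqrt (4 * t - (y - 1 - t) ^ 2) / (2 * PI))).
  assert (Hw : forall j k y, continuous (w j k) y).
  { intros j l y. unfold w, Rdiv. apply (continuous_mult (K := R_AbsRing)).
    - apply (continuous_derivable (fun y => y ^ j * (y - t) ^ l)). intros z. auto_derive. auto.
    - apply (continuous_mult (K := R_AbsRing)); [|apply continuous_const].
      apply continuous_sqrt_comp.
      apply (continuous_derivable (fun y => 4 * t - (y - 1 - t) ^ 2)).
      intros z. auto_derive. auto. }
  (* The power of [x] is left free because expanding one factor x - t raises it. It exceeds the [j]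
     of the integrand by one, on account of the 1/x in the density. *)
  assert (Hmom : forall k j,
    phi (mul (npow x (S j)) (npow (add x (scal (- t) one)) k))
    = RInt.RInt (w j k) ((sqrt t - 1) ^ 2) ((sqrt t + 1) ^ 2)).
  { clear k. induction k as [|k IH]; intros j.
    - cbn [npow]. rewrite mul_oner. change (mul x (npow x j)) with (npow x (S j)).
      rewrite Hx. unfold mom_pi. rewrite pow_i, Rmult_0_r, Rplus_0_l by lia.
      rewrite <- RInt_Defs by apply Hw. f_equal.
      apply functional_extensionality. intros y. unfold w, Rdiv. simpl. ring.
    - rewrite (RInt_ext_R _ (fun y => 1 * w (S j) k y + (- t) * w j k y)).
      + rewrite RInt_linear, <- !IH by apply Hw. cbn [npow].
        rewrite mul_addl, mul_addr, mul_scall, mul_scalr, phi_add, phi_scal, mul_onel.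
        rewrite Rmult_1_l. f_equal. f_equal. rewrite mul_assoc. f_equal.
        change (mul (npow x (S j)) x = npow x (S (S j))). now rewrite (npow_succ_r x (S j)).
      + intros y _. unfold w. simpl. ring. }
  specialize (Hmom k O). cbn [npow] in Hmom. rewrite mul_oner in Hmom. rewrite Hmom.
  set (p := sqrt t) in *.
  rewrite (RInt_ext_R _ (fun y =>
    / (2 * PI) * semicircle p (t + 1) k y + 0 * semicircle p (t + 1) k y)).
  - replace ((p - 1) ^ 2) with (t + 1 - 2 * p) by (rewrite <- Hs; ring).
    replace ((p + 1) ^ 2) with (t + 1 + 2 * p) by (rewrite <- Hs; ring).
    rewrite RInt_linear, semicircle_integral by (apply semicircle_continuous || apply sqrt_pos).
    rewrite Hs. field. apply PI_neq0.
  - intros y _. unfold w, semicircle. rewrite Hs.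
    replace (y - (t + 1) + 1) with (y - t) by ring.
    replace (y - (t + 1)) with (y - 1 - t) by ring. unfold Rdiv. simpl. ring.
Qed.

(** Induction through (x - t)^(k+1) = x (x - t)^k - t (x - t)^k, where [mom_pi_shift] evaluates the
    first term and [jac_poisson_semicircle] combines the two. *)
Lemma centred_pi_moment {A : ncps} (x : car A) t k : 0 <= t -> has_law_pi x t ->
  phi (npow (add x (scal (- t) one)) k) = jac (sqrt t) 0 1 k 0.
Proof.
  intros Ht Hx. assert (Hs : sqrt t * sqrt t = t) by (apply sqrt_sqrt; lra).
  induction k as [|k IH]; [apply phi_one|].
  cbn [npow]. rewrite mul_addl, mul_scall, mul_onel, phi_add, phi_scal, IH, mom_pi_shift by auto.
  rewrite <- Hs at 1 3.
  generalize (jac_poisson_semicircle (sqrt t) k 0). intros E. simpl.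
  transitivity (sqrt t * (sqrt t * jac (sqrt t) 1 1 k 0) - sqrt t * sqrt t * jac (sqrt t) 0 1 k 0);
    [|rewrite E]; ring.
Qed.

(** * The Fock space model *)

(* The algebra of all linear operators on functions of binary words, which
   contains the full Fock space over a plane; [nil] is the vacuum. *)
Section Fock.

Definition vec := list bool -> R.
Definition vadd (f g : vec) : vec := fun w => f w + g w.
Definition vscal (r : R) (f : vec) : vec := fun w => r * f w.

Record op := Op {
  op_fun :> vec -> vec;
  op_fun_add : forall f g, op_fun (vadd f g) = vadd (op_fun f) (op_fun g);
  op_fun_scal : forall r f, op_fun (vscal r f) = vscal r (op_fun f)
}.

Lemma op_eq (S T : op) : (forall f w, S f w = T f w) -> S = T.
Proof.
  intros H. destruct S as [S S1 S2], T as [T T1 T2]. simpl in H.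
  assert (E : S = T).
  { apply functional_extensionality. intros f. now apply functional_extensionality. }
  subst T. f_equal; apply proof_irrelevance.
Qed.

Ltac vec_solve :=
  intros; unfold vadd, vscal; try apply functional_extensionality; intros; simpl; ring.

Program Definition op_zero := Op (fun _ _ => 0) _ _.
Solve Obligations with vec_solve.
Program Definition op_one := Op (fun f => f) _ _.
Program Definition op_add (S T : op) := Op (fun f => vadd (S f) (T f)) _ _.
Next Obligation. rewrite !op_fun_add. vec_solve. Qed.
Next Obligation. rewrite !op_fun_scal. vec_solve. Qed.
Program Definition op_scal (r : R) (T : op) := Op (fun f => vscal r (T f)) _ _.
Next Obligation. rewrite !op_fun_add. vec_solve. Qed.
Next Obligation. rewrite !op_fun_scal. vec_solve. Qed.
Program Definition op_mul (S T : op) := Op (fun f => S (T f)) _ _.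
Next Obligation. now rewrite !op_fun_add. Qed.
Next Obligation. now rewrite !op_fun_scal. Qed.

Definition vacuum : vec := fun w => match w with nil => 1 | _ => 0 end.

Program Definition fock : ncps := {|
  car := op; zero := op_zero; one := op_one; add := op_add; mul := op_mul;
  scal := op_scal; phi := fun T => T vacuum nil
|}.
Solve Obligations with
  intros; try apply op_eq; intros; simpl; rewrite ?op_fun_add, ?op_fun_scal;
  unfold vadd, vscal; simpl; ring.

(* A creation operator [L] with left inverse [L']: in the Chebyshev basis
   [L^j vacuum] the operator [al + p (L + L')] is tridiagonal. *)
Lemma tridiagonal_moments (L L' : op) (al p : R) (x : car fock) k :
  (forall f, L' (L f) = f) -> L' vacuum = (fun _ => 0) -> (forall f, L f nil = 0) ->
  (forall f, (x : op) f = vadd (vscal al f) (vscal p (vadd (L f) (L' f)))) ->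
  phi (npow x k) = jac p al al k 0.
Proof.
  intros HL HO HL0 Hx.
  assert (Hlin : forall T : op, (T (fun _ => 0)) = (fun _ => 0)).
  { intros T. replace (fun _ => 0) with (vscal 0 vacuum) at 1 by vec_solve.
    rewrite op_fun_scal. vec_solve. }
  (* The entry (0, j) of the matrix power is the vacuum coefficient of x^k L^j [vacuum]. *)
  enough (H : forall j, (npow x k : op) (Nat.iter j L vacuum) nil = jac p al al k j)
    by exact (H O).
  induction k as [|k IH]; intros j.
  - destruct j; simpl; auto.
  - rewrite npow_succ_r.
    change ((npow x k : op) ((x : op) (Nat.iter j L vacuum)) nil = jac p al al (S k) j).
    rewrite Hx, op_fun_add, !op_fun_scal, op_fun_add. unfold vadd, vscal.
    change (L (Nat.iter j L vacuum)) with (Nat.iter (S j) L vacuum).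
    rewrite !IH. destruct j as [|j].
    + simpl Nat.iter. rewrite HO, Hlin. cbn [jac]. ring.
    + change (Nat.iter (S j) L vacuum) with (L (Nat.iter j L vacuum)).
      rewrite HL, IH. cbn [jac]. ring.
Qed.

Program Definition creation (i : bool) :=
  Op (fun f w => match w with nil => 0 | j :: w => if Bool.eqb i j then f w else 0 end) _ _.
Solve Obligations with
  intros; apply functional_extensionality; intros [|j w]; unfold vadd, vscal;
  [|destruct (Bool.eqb i j)]; ring.

Program Definition annihilation (i : bool) := Op (fun f w => f (i :: w)) _ _.

Definition semicircular (p : R) (i : bool) : car fock :=
  op_scal p (op_add (creation i) (annihilation i)).

Lemma annihilation_creation i f : annihilation i (creation i f) = f.
Proof.
  apply functional_extensionality. intros w. simpl. now rewrite Bool.eqb_reflx.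
Qed.

Lemma annihilation_creation_neq i j f :
  i <> j -> annihilation i (creation j f) = (fun _ => 0).
Proof.
  intros Hij. apply functional_extensionality. intros w. simpl.
  now replace (Bool.eqb j i) with false by (symmetry; apply Bool.eqb_false_iff; congruence).
Qed.

Lemma semicircular_moments p i k : phi (npow (semicircular p i) k) = jac p 0 0 k 0.
Proof.
  apply (tridiagonal_moments (creation i) (annihilation i)).
  - apply annihilation_creation.
  - reflexivity.
  - reflexivity.
  - intros f. simpl. vec_solve.
Qed.

(* Difference of two free semicirculars: the isometry is now
   [(creation true - creation false) / sqrt 2]. *)
Lemma semicircular_sub_moments p k :
  phi (npow (add (scal 1 one) (sub (semicircular p true) (semicircular p false))) k)
  = jac (sqrt 2 * p) 1 1 k 0.
Proof.
  assert (Hs : sqrt 2 * sqrt 2 = 2) by (apply sqrt_sqrt; lra).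
  assert (Hs0 : sqrt 2 <> 0) by (intros E; rewrite E in Hs; lra).
  apply (tridiagonal_moments
    (op_scal (/ sqrt 2) (op_add (creation true) (op_scal (-1) (creation false))))
    (op_scal (/ sqrt 2) (op_add (annihilation true) (op_scal (-1) (annihilation false))))).
  - intros f. apply functional_extensionality. intros w. simpl. unfold vscal, vadd. simpl.
    transitivity (2 / (sqrt 2 * sqrt 2) * f w); [field; auto | rewrite Hs; field].
  - apply functional_extensionality. intros w. simpl. unfold vscal, vadd. ring.
  - intros f. simpl. unfold vscal, vadd. simpl. ring.
  - intros f. simpl. unfold vscal, vadd. apply functional_extensionality. intros w. simpl.
    field. auto.
Qed.

(** The sum of c_j L^j f for L = [creation i]. *)
Fixpoint creation_series (i : bool) (cs : list R) (f : vec) : vec :=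
  match cs with
  | nil => fun _ => 0
  | c :: cs => vadd (vscal c f) (creation i (creation_series i cs f))
  end.

Lemma creation_series_padd i cs ds f :
  creation_series i (padd cs ds) f = vadd (creation_series i cs f) (creation_series i ds f).
Proof.
  revert ds. induction cs as [|c cs IH]; intros [|d ds]; cbn [padd creation_series].
  1-3: vec_solve.
  rewrite IH, op_fun_add. apply functional_extensionality. intros w. unfold vadd, vscal. ring.
Qed.

Lemma creation_series_pscal i r cs f :
  creation_series i (map (Rmult r) cs) f = vscal r (creation_series i cs f).
Proof.
  induction cs as [|c cs IH]; cbn [map creation_series]; [vec_solve|].
  rewrite IH, op_fun_scal. apply functional_extensionality. intros w. unfold vadd, vscal. ring.
Qed.

(** If f is annihilated, the span of the L^j f is stable: creation shifts the coefficients up and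
    annihilation shifts them down. The coefficients do not depend on f, so they can be read off at
    the vacuum and used on vectors created by the other semicircular. *)
Lemma peval_semicircular p i q :
  exists cs, forall f, annihilation i f = (fun _ => 0) ->
    (peval q (semicircular p i) : op) f = creation_series i cs f.
Proof.
  induction q as [|c q (cs & Hcs)].
  - exists nil. reflexivity.
  - exists (padd (c :: nil) (map (Rmult p) (padd (0 :: cs) (tl cs)))). intros f Hf.
    rewrite creation_series_padd, creation_series_pscal, creation_series_padd.
    simpl peval. specialize (Hcs f Hf).
    transitivity (vadd (vscal c f) (vscal p (vadd
             (creation i ((peval q (semicircular p i) : op) f))
             (annihilation i ((peval q (semicircular p i) : op) f))))); [reflexivity|].
    rewrite Hcs. f_equal.
    + apply functional_extensionality. intros w. simpl. unfold vadd, vscal.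
      destruct w as [|j w]; [|destruct (Bool.eqb i j)]; ring.
    + f_equal. f_equal.
      * simpl. apply functional_extensionality. intros w. unfold vadd, vscal. ring.
      * destruct cs as [|c' cs]; [reflexivity|]. simpl tl. cbn [creation_series].
        rewrite op_fun_add, op_fun_scal, annihilation_creation, Hf.
        apply functional_extensionality. intros w. unfold vadd, vscal. ring.
Qed.

(* A centred polynomial in the i-th semicircular maps the vacuum, and every
   vector created by the other one, into the range of [creation i]. *)
Lemma free_semicircular p : free (semicircular p true) (semicircular p false).
Proof.
  intros l Hnil Halt H0.
  enough (H : exists f, (word (semicircular p true) (semicircular p false) l : op) vacuum
                = match l with nil => vacuum | (i, _) :: _ => creation i f end).
  { destruct H as [f Hf]. destruct l as [|[i q] l]; [easy|].
    change ((word (semicircular p true) (semicircular p false) ((i, q) :: l) : op) vacuum nil = 0).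
    rewrite Hf. reflexivity. }
  clear Hnil. induction l as [|[i q] l IH].
  - now exists vacuum.
  - inversion_clear H0.
    assert (Halt' : alternating l) by (destruct l as [|[j q'] l]; [exact I | apply Halt]).
    destruct (IH Halt' H1) as [f Hf]. clear IH H1.
    assert (Hl : letter (semicircular p true) (semicircular p false) (i, q)
                 = peval q (semicircular p i)) by now destruct i.
    rewrite Hl in H.
    destruct (peval_semicircular p i q) as [cs Hcs].
    set (g := match l with nil => vacuum | (j, _) :: _ => creation j f end) in Hf.
    assert (Hg : annihilation i g = (fun _ => 0)).
    { unfold g. destruct l as [|[j q'] l]; [reflexivity|].
      apply annihilation_creation_neq. apply Halt. }
    assert (Hg' : (word (semicircular p true) (semicircular p false) ((i, q) :: l) : op) vacuum
                  = creation_series i cs g).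
    { rewrite <- (Hcs g Hg), <- Hf, <- Hl. reflexivity. }
    rewrite Hg'. exists (creation_series i (tl cs) g).
    (* The vacuum coefficient of [creation_series i cs vacuum] is the head of [cs], so centring
       makes it 0. *)
    change ((peval q (semicircular p i) : op) vacuum nil = 0) in H.
    rewrite (Hcs vacuum eq_refl) in H.
    destruct cs as [|c cs]; simpl.
    + apply functional_extensionality. intros [|j w]; [|destruct (Bool.eqb i j)]; reflexivity.
    + simpl in H. unfold vadd, vscal in *. simpl in H.
      replace c with 0 by lra. apply functional_extensionality. intros w. simpl. ring.
Qed.

End Fock.

(** * Limits *)

Lemma in_alg_affine {A : ncps} (x : car A) r s : in_alg x (scal r (add x (scal s one))).
Proof.
  exists (r * s :: r :: nil). simpl. indist_solve.
Qed.

Lemma scaled_pi_moment {A : ncps} (x : car A) r t k : 0 <= t -> has_law_pi x t ->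
  phi (npow (scal r (add x (scal (- t) one))) k) = jac (r * sqrt t) 0 r k 0.
Proof.
  intros Ht Hx. rewrite npow_indist_scal, phi_scal, (centred_pi_moment x t) by auto.
  rewrite <- jac_scal. f_equal; ring.
Qed.

Lemma lim_pinf_is_lim f (l : R) : lim_pinf f l <-> is_lim f p_infty l.
Proof.
  rewrite <- is_lim_spec. split.
  - intros H eps. destruct (H eps (cond_pos eps)) as [M HM].
    exists M. intros x Hx. apply HM. lra.
  - intros H eps Heps. destruct (H (mkposreal eps Heps)) as [M HM].
    exists (M + 1). intros x Hx. apply HM. simpl. lra.
Qed.

Section Limit.

Variable P : R -> Prop.

(* Functions on the half-line extended by the point [None] at infinity, and
   continuous there. *)
Definition cont_at_infty (g : option {x | P x} -> R) :=
  exists f, is_lim f p_infty (g None) /\ forall s, g (Some s) = f (proj1_sig s).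

Lemma cont_at_infty_const r : cont_at_infty (fun _ => r).
Proof.
  exists (fun _ => r). split; auto. apply is_lim_const.
Qed.

Lemma cont_at_infty_add g h :
  cont_at_infty g -> cont_at_infty h -> cont_at_infty (fun i => g i + h i).
Proof.
  intros (f & Hf & Ef) (f' & Hf' & Ef'). exists (fun x => f x + f' x). split.
  - now apply is_lim_plus'.
  - intros s. now rewrite Ef, Ef'.
Qed.

Lemma cont_at_infty_mul g h :
  cont_at_infty g -> cont_at_infty h -> cont_at_infty (fun i => g i * h i).
Proof.
  intros (f & Hf & Ef) (f' & Hf' & Ef'). exists (fun x => f x * f' x). split.
  - exact (is_lim_mult f f' p_infty _ _ Hf Hf' I).
  - intros s. now rewrite Ef, Ef'.
Qed.

Lemma cont_at_infty_jac p al k j :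
  cont_at_infty p -> cont_at_infty al -> cont_at_infty (fun i => jac (p i) 0 (al i) k j).
Proof.
  intros Hp Hal. revert j. induction k as [|k IH]; intros [|j]; cbn [jac].
  - apply cont_at_infty_const.
  - apply cont_at_infty_const.
  - exact (cont_at_infty_add _ _ (cont_at_infty_mul _ _ (cont_at_infty_const 0) (IH O))
             (cont_at_infty_mul p _ Hp (IH 1%nat))).
  - exact (cont_at_infty_add _ _
             (cont_at_infty_add _ _ (cont_at_infty_mul p _ Hp (IH j))
                (cont_at_infty_mul al _ Hal (IH (S j))))
             (cont_at_infty_mul p _ Hp (IH (S (S j))))).
Qed.

(** The limiting pair is adjoined as the member with index [None]. The functions continuous at
    infinity form an algebra containing the marginal moments, hence also the moments of the
    difference. *)
Lemma free_sub_limit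
  (F : R -> ncps) (a b : forall x, car (F x)) (A0 : ncps) (a0 b0 : car A0)
  (p q al z : R -> R) (p0 q0 al0 z0 : R) k :
  (exists M, forall x, M < x -> P x) ->
  (forall x, P x -> free (a x) (b x)) -> free a0 b0 ->
  (forall x, P x -> forall k, phi (npow (a x) k) = jac (p x) 0 (al x) k 0) ->
  (forall x, P x -> forall k, phi (npow (b x) k) = jac (q x) 0 (al x) k 0) ->
  (forall k, phi (npow a0 k) = jac p0 0 al0 k 0) ->
  (forall k, phi (npow b0 k) = jac q0 0 al0 k 0) ->
  is_lim p p_infty p0 -> is_lim q p_infty q0 -> is_lim al p_infty al0 -> is_lim z p_infty z0 ->
  is_lim (fun x => phi (npow (add (scal (z x) one) (sub (a x) (b x))) k)) p_infty
         (phi (npow (add (scal z0 one) (sub a0 b0)) k)).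
Proof.
  intros HP Hfree Hfree0 Ha Hb Ha0 Hb0 Hp Hq Hal Hz.
  set (F' := fun i : option {x | P x} =>
    match i with Some s => F (proj1_sig s) | None => A0 end).
  set (a' := fun i => match i return car (F' i) with
    Some s => a (proj1_sig s) | None => a0 end).
  set (b' := fun i => match i return car (F' i) with
    Some s => b (proj1_sig s) | None => b0 end).
  set (ext := fun (f : R -> R) (l : R) (i : option {x | P x}) =>
    match i with Some s => f (proj1_sig s) | None => l end).
  assert (Hext : forall f (l : R), is_lim f p_infty l -> cont_at_infty (ext f l))
    by (intros f l Hf; now exists f).
  destruct (free_sub_moments _ cont_at_infty cont_at_infty_const cont_at_infty_add
    cont_at_infty_mul F' a' b') with (z := ext z z0) (k := k) as (f & Hf & Ef).
  - intros [[x Hx]|]; simpl; auto.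
  - intros j. eapply C_ext.
    + exact (cont_at_infty_jac (ext p p0) (ext al al0) j 0 (Hext _ _ Hp) (Hext _ _ Hal)).
    + intros [[x Hx]|]; simpl; symmetry; auto.
  - intros j. eapply C_ext.
    + exact (cont_at_infty_jac (ext q q0) (ext al al0) j 0 (Hext _ _ Hq) (Hext _ _ Hal)).
    + intros [[x Hx]|]; simpl; symmetry; auto.
  - auto.
  - apply (is_lim_ext_loc f).
    + destruct HP as [M HM]. exists M. intros x Hx. symmetry.
      exact (Ef (exist _ x (HM x Hx))).
    + exact Hf.
Qed.

End Limit.

Lemma is_lim_inv_infty (g : R -> R) :
  continuous g 0 -> is_lim (fun x => g (/ x)) p_infty (g 0).
Proof.
  intros Hg. apply (is_lim_comp_continuous Rinv g p_infty 0); auto.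
  apply (is_lim_inv (fun x => x) p_infty p_infty); [apply is_lim_id | discriminate].
Qed.

(** * The case n = 1: subtracting a null variable *)

Lemma free_zero {A : ncps} (a : car A) : free a zero.
Proof.
  assert (H0 : forall p, phi (letter a zero (false, p)) = 0 ->
    letter a zero (false, p) == scal 0 one).
  { intros [|c p] H.
    - apply zero_indist.
    - assert (E : letter a zero (false, c :: p) == scal c one)
        by (unfold letter; simpl; indist_solve).
      rewrite E, phi_scal, phi_one in H. rewrite E. now replace c with 0 by lra. }
  (* A single letter in [a] is centred by hypothesis; any other alternating word has a letter in
     [zero] among its first two, and [H0] makes it null. *)
  intros [|[[|] p] l] Hnil Halt Hl; [easy| |];
    inversion_clear Hl as [|? ? H Hl']; cbn [word fold_right].
  - destruct l as [|[[|] q] l].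
    + simpl. now rewrite mul_oner.
    + now destruct Halt.
    + inversion_clear Hl' as [|? ? Hq _]. cbn [fold_right].
      rewrite (H0 q Hq), mul_scall, mul_scalr, phi_scal. ring.
  - rewrite (H0 p H), mul_scall, phi_scal. ring.
Qed.

Lemma pi_zero_moment {A : ncps} (b : car A) k :
  has_law_pi b 0 -> phi (npow b k) = phi (npow (@zero A) k).
Proof.
  intros Hb. destruct k as [|k]; [reflexivity|].
  assert (E : b == add b (scal (- 0) one)) by indist_solve.
  rewrite E, (centred_pi_moment b 0) by (auto; lra).
  assert (E' : npow (@zero A) (S k) == scal 0 one) by (simpl; indist_solve).
  rewrite E', phi_scal, sqrt_0. simpl. ring.
Qed.

(** Universality over a two-point parameter space, with the algebra of functions that agree at both
    points, compares the pair (a, b) with (a, 0). *)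
Lemma free_sub_null {A : ncps} (a b : car A) k :
  free a b -> (forall k, phi (npow b k) = phi (npow (@zero A) k)) ->
  phi (npow (sub a b) k) = phi (npow a k).
Proof.
  intros Hfree Hb.
  assert (E : sub a b == add (scal 0 one) (sub a b)) by indist_solve.
  assert (E' : a == add (scal 0 one) (sub a zero)) by (unfold sub; indist_solve).
  rewrite E. rewrite E' at 2.
  apply (free_sub_moments bool (fun g => g true = g false)) with
    (F := fun _ => A) (a := fun _ => a) (b := fun i : bool => if i then b else zero)
    (z := fun _ => 0); try congruence.
  intros [|]; auto. apply free_zero.
Qed.

(** * The two limit regimes *)

Lemma diff_limit_SC (beta : R) (F : R -> ncps) (a b : forall m, car (F m)) k : 0 < beta ->
  (forall m, 0 <= m -> 1 <= beta * m -> realizes_mu m (beta * m) (F m) (a m) (b m)) ->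
  lim_pinf (fun m => phi (npow (scal (/ m) (sub (a m) (b m))) k)) (mom_SC beta k).
Proof.
  intros Hbeta Hab. apply lim_pinf_is_lim.
  set (s := fun m => m * (beta * m + 1) / 2). set (r := fun m => m * (beta * m - 1) / 2).
  set (P := fun m => 0 < m /\ 1 <= beta * m).
  assert (HP : forall m, / beta < m -> P m).
  { intros m Hm. assert (H := Rinv_0_lt_compat _ Hbeta). split; [lra|].
    apply (Rmult_lt_compat_l beta) in Hm; auto. rewrite Rinv_r in Hm; lra. }
  (* e = 1 and e = -1 give the two rates; after division by m the square root is that of (beta +
     e/m)/2. *)
  assert (Hlim : forall e, (forall m, P m -> 0 <= m * (beta * m + e) / 2) ->
    is_lim (fun m => / m * sqrt (m * (beta * m + e) / 2)) p_infty (sqrt (beta / 2))).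
  { intros e He. apply (is_lim_ext_loc (fun m => sqrt ((beta + e * / m) / 2))).
    - exists (/ beta). intros m Hm. specialize (HP m Hm). destruct HP as [Hm0 _].
      assert (Hi := Rinv_0_lt_compat _ Hm0).
      rewrite <- (sqrt_square (/ m)) at 2 by lra.
      rewrite <- sqrt_mult_alt by (apply Rmult_le_pos; lra). f_equal. field. lra.
    - replace (beta / 2) with ((beta + e * 0) / 2) by field.
      apply (is_lim_inv_infty (fun u => sqrt ((beta + e * u) / 2))).
      apply continuous_sqrt_comp.
      apply (continuous_derivable (fun u => (beta + e * u) / 2)). intros u. auto_derive. auto. }
  assert (Hs : forall m, P m -> 0 <= s m).
  { intros m [H1 H2]. unfold s. assert (0 <= m * (beta * m + 1)) by (apply Rmult_le_pos; lra). lra. }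
  assert (Hr : forall m, P m -> 0 <= r m).
  { intros m [H1 H2]. unfold r. assert (0 <= m * (beta * m - 1)) by (apply Rmult_le_pos; lra). lra. }
  rewrite mom_SC_jac by auto.
  replace (sqrt beta) with (sqrt 2 * sqrt (beta / 2))
    by (rewrite <- sqrt_mult_alt by lra; f_equal; field).
  rewrite <- semicircular_sub_moments.
  (* The dilated centred variables have diagonal entries 0, 1/m, 1/m, ..., which vanish in the limit
     and leave semicirculars of variance beta/2. The difference of the means, (s - r)/m, is exactly
     the shift 1. *)
  eapply is_lim_ext_loc; [|apply (free_sub_limit P F
    (fun m => scal (/ m) (add (a m) (scal (- s m) one)))
    (fun m => scal (/ m) (add (b m) (scal (- r m) one))))
    with (p := fun m => / m * sqrt (s m)) (q := fun m => / m * sqrt (r m))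
         (al := Rinv) (z := fun _ => 1) (p0 := sqrt (beta / 2)) (q0 := sqrt (beta / 2)) (al0 := 0)].
  - exists (/ beta). intros m Hm. destruct (HP m Hm) as [Hm0 _].
    assert (E : add (scal 1 one) (sub (scal (/ m) (add (a m) (scal (- s m) one)))
                                      (scal (/ m) (add (b m) (scal (- r m) one))))
                == scal (/ m) (sub (a m) (b m))).
    { unfold s, r. indist_solve. field. lra. }
    now rewrite E.
  - now exists (/ beta).
  - intros m [H1 H2]. destruct (Hab m) as [Hfree _]; [lra|auto|].
    apply (free_in_alg (a m) (b m)); auto; apply in_alg_affine.
  - apply free_semicircular.
  - intros m HPm j. apply scaled_pi_moment; auto. destruct HPm. apply Hab; lra.
  - intros m HPm j. apply scaled_pi_moment; auto. destruct HPm. apply Hab; lra.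
  - intros j. apply semicircular_moments.
  - intros j. apply semicircular_moments.
  - apply Hlim. exact Hs.
  - apply (Hlim (-1)). exact Hr.
  - apply (is_lim_inv_infty (fun u => u)). apply continuous_id.
  - apply is_lim_const.
Qed.

Lemma diff_limit_bessel (t : R) (A0 : ncps) (a0 b0 : car A0)
  (F : R -> ncps) (a b : forall n, car (F n)) k : 0 < t ->
  free a0 b0 -> has_law_pi a0 (t / 2) -> has_law_pi b0 (t / 2) ->
  (forall n, 1 <= n -> realizes_mu (t / n) n (F n) (a n) (b n)) ->
  lim_pinf (fun n => phi (npow (sub (a n) (b n)) k)) (phi (npow (sub a0 b0) k)).
Proof.
  intros Ht Hfree0 Ha0 Hb0 Hab. apply lim_pinf_is_lim.
  set (s := fun n => t / n * (n + 1) / 2). set (r := fun n => t / n * (n - 1) / 2).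
  assert (Hlim : forall e, is_lim (fun n => 1 * sqrt (t / n * (n + e) / 2)) p_infty (1 * sqrt (t / 2))).
  { intros e. apply (is_lim_ext_loc (fun n => 1 * sqrt ((t + t * e * / n) / 2))).
    - exists 0. intros n Hn. do 2 f_equal. field. lra.
    - replace (t / 2) with ((t + t * e * 0) / 2) by field.
      apply (is_lim_inv_infty (fun u => 1 * sqrt ((t + t * e * u) / 2))).
      apply (continuous_scal_r (V := R_NormedModule)).
      apply continuous_sqrt_comp.
      apply (continuous_derivable (fun u => (t + t * e * u) / 2)). intros u. auto_derive. auto. }
  assert (Hpos : forall n e, 1 <= n -> 0 <= n + e -> 0 <= t / n * (n + e) / 2).
  { intros n e Hn He. assert (H := Rinv_0_lt_compat n ltac:(lra)).
    unfold Rdiv. repeat apply Rmult_le_pos; lra. }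
  (* The limiting variables have equal means, so centring both leaves the shift 0; the dilation by 1
     matches [scaled_pi_moment]. *)
  assert (E0 : sub a0 b0 == add (scal 0 one) (sub (scal 1 (add a0 (scal (- (t / 2)) one)))
                                                 (scal 1 (add b0 (scal (- (t / 2)) one)))))
    by indist_solve.
  rewrite E0.
  eapply is_lim_ext_loc; [|apply (free_sub_limit (fun n => 1 <= n) F
    (fun n => scal 1 (add (a n) (scal (- s n) one)))
    (fun n => scal 1 (add (b n) (scal (- r n) one))))
    with (p := fun n => 1 * sqrt (s n)) (q := fun n => 1 * sqrt (r n))
         (al := fun _ => 1) (z := fun n => t * / n)
         (p0 := 1 * sqrt (t / 2)) (q0 := 1 * sqrt (t / 2)) (al0 := 1)].
  - exists 0. intros n Hn.
    (* Here the means differ by s - r = t/n, which tends to 0. *)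
    assert (E : add (scal (t * / n) one) (sub (scal 1 (add (a n) (scal (- s n) one)))
                                      (scal 1 (add (b n) (scal (- r n) one))))
                == sub (a n) (b n)).
    { unfold s, r. indist_solve. field. lra. }
    now rewrite E.
  - exists 1. intros n Hn. lra.
  - intros n Hn. destruct (Hab n Hn) as [Hfree _].
    apply (free_in_alg (a n) (b n)); auto; apply in_alg_affine.
  - apply (free_in_alg a0 b0); auto; apply in_alg_affine.
  - intros n Hn j. apply scaled_pi_moment; [apply Hpos; lra | apply (Hab n Hn)].
  - intros n Hn j. apply scaled_pi_moment; [apply (Hpos n (-1)); lra | apply (Hab n Hn)].
  - intros j. apply scaled_pi_moment; auto; lra.
  - intros j. apply scaled_pi_moment; auto; lra.
  - apply Hlim.
  - apply (Hlim (-1)).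
  - apply is_lim_const.
  - rewrite <- (Rmult_0_r t). apply (is_lim_inv_infty (fun u => t * u)).
    apply (continuous_derivable (fun u => t * u)). intros u. auto_derive. auto.
Qed.

Theorem theorem4p3 :
  (* (1) mu_{m,1} = pi_m *)
  (forall (m : R), 0 <= m ->
     forall (A : ncps) (a b : car A), realizes_mu m 1 A a b ->
       forall k, phi (npow (sub a b) k) = mom_pi m k)
  /\
  (* (2) D_{1/m}(mu_{m, beta m}) -> SC(1,beta) as m -> infinity *)
  (forall (beta : R), 0 < beta ->
     forall (F : R -> ncps) (a b : forall m, car (F m)),
       (forall m, 0 <= m -> 1 <= beta * m -> realizes_mu m (beta * m) (F m) (a m) (b m)) ->
       forall k, lim_pinf (fun m => phi (npow (scal (/ m) (sub (a m) (b m))) k)) (mom_SC beta k))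
  /\
  (* (3) mu_{t/n,n} -> law of a0 - b0, a0,b0 free, both ~ pi_{t/2}, as n -> infinity *)
  (forall (t : R), 0 < t ->
     forall (A0 : ncps) (a0 b0 : car A0),
       free a0 b0 -> has_law_pi a0 (t / 2) -> has_law_pi b0 (t / 2) ->
     forall (F : R -> ncps) (a b : forall n, car (F n)),
       (forall n, 1 <= n -> realizes_mu (t / n) n (F n) (a n) (b n)) ->
       forall k, lim_pinf (fun n => phi (npow (sub (a n) (b n)) k))
                          (phi (npow (sub a0 b0) k))).
Proof.
  split; [|split].
  - intros m Hm A a b (Hfree & Ha & Hb) k.
    replace (m * (1 + 1) / 2) with m in Ha by field.
    replace (m * (1 - 1) / 2) with 0 in Hb by field.
    rewrite <- (Ha k). apply free_sub_null; auto.
    intros j. now apply pi_zero_moment.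
  - intros beta Hbeta F a b Hab k. now apply diff_limit_SC.
  - intros t Ht A0 a0 b0 Hfree0 Ha0 Hb0 F a b Hab k. now apply (diff_limit_bessel t).
Qed.
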